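(* Suppose a control law $h:\mathbb{R}^m\to\mathbb{R}^n$ satisfies, for some $\alpha\in[0,1)$, for all $R\le 0$ and all $i\in\{1,\dots,n\}$, $$h(R)\in\mathcal{F}^I(R),\qquad h^i(R)+\gamma\|h(R)\|_\infty\le h_{\max}^i(R)+\alpha\|h_{\max}(R)\|_\infty.$$ Then the feedback $\Delta_t=h(\hat R_t)$ is geometrically normalizing for the update $$\hat R_{t+1}=\hat R_t+\hat B_t\Delta_t,\qquad \hat B_t=\gamma\hat F_t-S,$$ regardless of the sequence of row-stochastic matrices $\{\hat F_t\}_{t\in\mathbb{N}}\subset[0,1]^{m\times n}$ (equivalently, of the realization $\{\hat B_t\}_{t\in\mathbb{N}}$) and of the initial condition $\hat R_0\le 0$.
   Context: States are $\{1,\dots,n\}$; actions are $\{1,\dots,m\}$, partitioned into nonempty sets $U_1,\dots,U_n$ ($U_i$ = actions available in state $i$). $\gamma\in[0,1)$ is the discount factor. $S\in\{0,1\}^{m\times n}$ has $S^j_i=1$ iff $j\in U_i$. The map $h_{\max}:\mathbb{R}^m\to\mathbb{R}^n$ is $h_{\max}^i(R)=\max_{j\in U_i}R^j$. For $R\le 0$ (componentwise), $$\mathcal{F}^I(R):=\{\Delta\in\mathbb{R}^n:\ 0\ge\Delta^i\ge\gamma\Delta^k+R^j\ \ \forall i,k\in\{1,\dots,n\},\ \forall j\in U_i\}.$$ The normal set is $\mathcal{N}=\{R\in\mathbb{R}^m: h_{\max}(R)=0\}$. ''Geometrically normalizing'' means that $\hat R_t\le 0$ for all $t$ and $\hat R_t$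 converges to the normal set at a geometric rate, i.e. there are $C\ge0$ and $\rho\in[0,1)$ with $\|h_{\max}(\hat R_t)\|_\infty\le C\rho^t$ for all $t\in\mathbb{N}$. *)

(* Defs.v *)
(* MathComp / MathComp-Analysis *)
From mathcomp Require Export all_boot all_order all_algebra.
From mathcomp Require Export reals normedtype.
Export Order.TTheory GRing.Theory Num.Theory.
Export numFieldNormedType.Exports.

Global Set Implicit Arguments.
Global Unset Strict Implicit.
Global Unset Printing Implicit Defensive.

Local Open Scope ring_scope.

(* States are 'I_n and actions are 'I_m; vectors are column vectors.  On
   'cV[R]_n the library norm `|x| is the sup norm (see mx_normrE). *)

Definition action_partition (m n : nat) (U : 'I_n -> {set 'I_m}) : Prop :=
  [/\ forall i, U i != set0,
      forall i k, i != k -> [disjoint U i & U k] &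
      forall j, exists i, j \in U i].

Definition selection_mx (R : realType) (m n : nat) (U : 'I_n -> {set 'I_m}) :
    'M[R]_(m, n) :=
  \matrix_(j, i) (j \in U i)%:R.

Definition row_stochastic (R : realType) (m n : nat) (F : 'M[R]_(m, n)) : Prop :=
  (forall j i, 0 <= F j i <= 1) /\ (forall j, \sum_i F j i = 1).

Definition nonpos (R : realType) (m : nat) (r : 'cV[R]_m) : Prop :=
  forall j, r j 0 <= 0.

(* The iterated max needs a starting value; it is r j0 for some j0 in U i, so
   that this is the true maximum also when all the entries are negative.  The
   None branch is reached only if U i is empty. *)
Definition hmax (R : realType) (m n : nat) (U : 'I_n -> {set 'I_m})
    (r : 'cV[R]_m) : 'cV[R]_n :=
  \col_i (if [pick j in U i] is Some j0
          then \big[Num.max/r j0 0]_(j in U i) r j 0 else 0).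

Definition FI (R : realType) (m n : nat) (U : 'I_n -> {set 'I_m}) (gamma : R)
    (r : 'cV[R]_m) (D : 'cV[R]_n) : Prop :=
  forall i k j, j \in U i -> gamma * D k 0 + r j 0 <= D i 0 <= 0.

(* Convergence to the normal set {r | hmax U r = 0} is measured by the sup norm
   of hmax U.  C and rho may depend on the trajectory. *)
Definition geometrically_normalizing (R : realType) (m n : nat)
    (U : 'I_n -> {set 'I_m}) (Rhat : nat -> 'cV[R]_m) : Prop :=
  (forall t, nonpos (Rhat t)) /\
  exists C rho : R,
    [/\ 0 <= C, 0 <= rho < 1 & forall t, `|hmax U (Rhat t)| <= C * rho ^+ t].

(* Main.v *)
(* Let Delta = h(R) and let R' be the updated vector.  For an action j of state i,
   R'^j = R^j - Delta^i + (a convex combination of the gamma Delta^k).  The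
   feasibility constraints say that R'^j <= 0.  For j attaining h_max^i(R), the
   convex combination is at least -gamma ||Delta||, and the second hypothesis
   gives R'^j >= -alpha ||h_max(R)||.  Hence ||h_max(R')|| <= alpha ||h_max(R)||. *)

Require Import Defs.
From mathcomp Require Import lra.

Local Open Scope ring_scope.

(** The norm unfolds to an iterated max started at 0, which is its value when [n = 0]; [0 <= M]
    covers this starting value. *)
Lemma normcV_leP (R : realType) (n : nat) (v : 'cV[R]_n) (M : R) :
  0 <= M -> reflect (forall i, `|v i 0| <= M) (`|v| <= M).
Proof.
move=> M0; rewrite [`|v|]mx_normrE.
apply: (iffP (bigmax_leP _ _ _ _)) => [[_ le_vM] i|le_vM].
  exact: (le_vM (i, 0)).
by split=> // -[i j] _ /=; rewrite (ord1 j).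
Qed.

Lemma normcV_ge_entry (R : realType) (n : nat) (v : 'cV[R]_n) (i : 'I_n) :
  `|v i 0| <= `|v|.
Proof. by move: i; apply/normcV_leP. Qed.

Section Hmax.
Variables (R : realType) (m n : nat) (U : 'I_n -> {set 'I_m}).
Implicit Types (r : 'cV[R]_m) (i : 'I_n) (j : 'I_m).

Lemma hmax_ge r i j : j \in U i -> r j 0 <= hmax U r i 0.
Proof.
move=> jU; rewrite mxE; case: pickP => [j0 _|/(_ j)]; last by rewrite jU.
exact: (le_bigmax_cond _ (fun j => r j 0)).
Qed.

Lemma hmax_attained r i : U i != set0 ->
  exists2 j, j \in U i & hmax U r i 0 = r j 0.
Proof.
move=> /set0Pn[j jU]; rewrite mxE; case: pickP => [j0 j0U|/(_ j)]; last by rewrite jU.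
(* Being an entry of [r] indexed by [U i] holds for the starting value [r j0 0] and passes to the
   max of two such entries. *)
elim/big_ind: _ => [|x y [a aU ->] [b bU ->]|k kU]; first by exists j0.
  by rewrite /Num.max; case: ifP => _; [exists b|exists a].
by exists k.
Qed.

End Hmax.

Section RowStochastic.
Variables (R : realType) (m n : nat) (F : 'M[R]_(m, n)).
Hypothesis hF : row_stochastic F.
Implicit Types (v : 'cV[R]_n) (c : R) (j : 'I_m).

Lemma row_stochastic_mul_le v c j :
  (forall k, v k 0 <= c) -> (F *m v) j 0 <= c.
Proof.
case: hF => F01 F1 le_vc.
(* Since row [j] sums to 1, [c] is the average of the constant [c], and the two sums compare
   termwise. *)
rewrite mxE -[leRHS]mul1r -(F1 j) mulr_suml; apply: ler_sum => k _.
by apply: ler_wpM2l => //; case/andP: (F01 j k).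
Qed.

Lemma row_stochastic_mul_ge v c j :
  (forall k, c <= v k 0) -> c <= (F *m v) j 0.
Proof.
move=> le_cv; rewrite -lerN2 -[X in X <= _](_ : (F *m - v) j 0 = _); last first.
  by rewrite mulmxN mxE.
by apply: row_stochastic_mul_le => k; rewrite mxE lerN2.
Qed.

End RowStochastic.

(** By disjointness [i] is the only state owning [j], so row [j] of the selection matrix is the unit
    row at [i]. *)
Lemma selection_mx_mulE (R : realType) (m n : nat) (U : 'I_n -> {set 'I_m})
    (D : 'cV[R]_n) (i : 'I_n) (j : 'I_m) :
  action_partition U -> j \in U i -> (selection_mx R U *m D) j 0 = D i 0.
Proof.
case=> _ dis _ jU; rewrite mxE (bigD1 i) //= mxE jU mul1r big1 ?addr0 // => k ki.
by rewrite mxE (disjointFl (dis k i ki) jU) mul0r.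
Qed.

Section OneStep.
Variables (R : realType) (m n : nat) (U : 'I_n -> {set 'I_m}).
Hypothesis hU : action_partition U.
Variables (gamma : R) (F : 'M[R]_(m, n)).
Hypothesis gamma0 : 0 <= gamma.
Hypothesis hF : row_stochastic F.
Variables (r : 'cV[R]_m) (D : 'cV[R]_n).

Let r' := r + (gamma *: F - selection_mx R U) *m D.

(** The factor [gamma] is moved onto [D] so that the row-stochastic bounds apply to the vector
    [gamma *: D]. *)
Lemma update_entry i j : j \in U i ->
  r' j 0 = r j 0 + (F *m (gamma *: D)) j 0 - D i 0.
Proof.
move=> jU; rewrite -(selection_mx_mulE D hU jU) /r' mulmxBl -scalemxAl scalemxAr.
by rewrite !mxE addrA.
Qed.

Lemma update_nonpos : FI U gamma r D -> nonpos r'.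
Proof.
move=> hD j; case: hU => _ _ /(_ j)[i jU]; rewrite (update_entry jU).
(* Feasibility at [i], [k], [j] bounds every [gamma * D k 0] by a quantity independent of [k], hence
   also their average. *)
have : (F *m (gamma *: D)) j 0 <= D i 0 - r j 0.
  apply: row_stochastic_mul_le => // k; rewrite mxE.
  by have /andP[] := hD i k j jU; lra.
lra.
Qed.

Lemma update_hmax_contraction (alpha : R) : 0 <= alpha -> FI U gamma r D ->
  (forall i, D i 0 + gamma * `|D| <= hmax U r i 0 + alpha * `|hmax U r|) ->
  `|hmax U r'| <= alpha * `|hmax U r|.
Proof.
move=> alpha0 hD hb; apply/normcV_leP => [|i]; first by rewrite mulr_ge0.
have [U0 _ _] := hU.
(* Two maximizers are used: [j'], for [r'], gives only the sign of the new maximum; [j], for the old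
   [r], gives its lower bound through the entry [r' j 0]. *)
have [j' _ hj'] := hmax_attained r' (U0 i).
have [j jU hj] := hmax_attained r (U0 i).
have h'0 : hmax U r' i 0 <= 0 by rewrite hj' update_nonpos.
have FD : - (gamma * `|D|) <= (F *m (gamma *: D)) j 0.
  apply: row_stochastic_mul_ge => // k; rewrite mxE -mulrN ler_wpM2l //.
  by have := normcV_ge_entry D k; rewrite ler_norml => /andP[].
have := hmax_ge r' jU; rewrite (update_entry jU) -hj => le_h'.
have := hb i => le_D.
rewrite ler_norml; apply/andP; split; last exact/(le_trans h'0)/mulr_ge0.
by move: FD le_h' le_D; lra.
Qed.

End OneStep.

Theorem theorem34 (R : realType) (m n : nat) (U : 'I_n -> {set 'I_m})
    (hU : action_partition U)
    (gamma : R) (hgamma : 0 <= gamma < 1)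
    (h : 'cV[R]_m -> 'cV[R]_n)
    (alpha : R) (halpha : 0 <= alpha < 1)
    (hFI : forall r : 'cV[R]_m, nonpos r -> FI U gamma r (h r))
    (hbound : forall (r : 'cV[R]_m) (i : 'I_n), nonpos r ->
       h r i 0 + gamma * `|h r| <= hmax U r i 0 + alpha * `|hmax U r|)
    (Fhat : nat -> 'M[R]_(m, n))
    (hFhat : forall t : nat, row_stochastic (Fhat t))
    (Rhat : nat -> 'cV[R]_m)
    (hR0 : nonpos (Rhat 0%N))
    (hupdate : forall t : nat,
       Rhat t.+1 = Rhat t + (gamma *: Fhat t - selection_mx R U) *m h (Rhat t)) :
  geometrically_normalizing U Rhat.
Proof.
have [gamma0 _] := andP hgamma; have [alpha0 _] := andP halpha.
have Rhat_le0 t : nonpos (Rhat t).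
  elim: t => // t IHt; rewrite hupdate.
  by apply: update_nonpos => //; apply: hFI.
(* The one-step contraction factor is the rate, and the initial distance is the constant. *)
split=> //; exists `|hmax U (Rhat 0%N)|, alpha; split=> //.
elim=> [|t IHt]; first by rewrite expr0 mulr1.
have : `|hmax U (Rhat t.+1)| <= alpha * `|hmax U (Rhat t)|.
  by rewrite hupdate; apply: update_hmax_contraction => // [|i];
    [apply: hFI|apply: hbound].
by move/le_trans; apply; rewrite exprS mulrCA ler_wpM2l.
Qed.
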